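(* Let $\alpha\in(0,1)$, $m>2$, $\theta_0>0$, $p\geq 1$, a vector $(\beta_1,\dots,\beta_p)^T\in\mathbb{R}^p$ such that all roots of $x^p-\beta_1x^{p-1}-\dots-\beta_p=0$ have modulus less than $1$, and $0=x_0<x_1<\dots<x_m=\infty$ be fixed. For $\gamma\ge0$ and a probability distribution $\Pi$ on $\mathbb{R}$ let $$\hat\alpha(\gamma,\Pi)=1-F_{m-2}\big(\chi_{m-2}(1-\alpha),\hat\lambda^2(\gamma,\Pi)\big)$$ be the asymptotic level of the symmetrized Pearson test, with $\hat\lambda^2(\gamma,\Pi)$ as defined in the context (so that $\hat\alpha(0,\Pi)=\alpha$). Then $$\sup_{\Pi}|\hat\alpha(\gamma,\Pi)-\alpha|\to0,\qquad\gamma\to0,$$ where the supremum is over all probability distributions $\Pi$ on $\mathbb{R}$.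
   Context: $F_{m-2}(\cdot,\lambda^2)$ is the distribution function of the noncentral chi-square distribution with $m-2$ degrees of freedom and noncentrality parameter $\lambda^2$; $\chi_{m-2}(1-\alpha)$ is the $(1-\alpha)$-quantile of the (central) chi-square distribution with $m-2$ degrees of freedom. $\Phi$ is the standard normal distribution function and $|\cdot|$ is the Euclidean norm. Noncentrality parameter. Let $p_j(\theta)=2[\Phi(x_j/\theta)-\Phi(x_{j-1}/\theta)]$, $j=1,\dots,m$, $\theta>0$; $\boldsymbol P(\theta)=\mathrm{diag}\{p_1(\theta),\dots,p_m(\theta)\}$; $\boldsymbol p'(\theta)=(p_1'(\theta),\dots,p_m'(\theta))^T$ (derivatives in $\theta$); $\boldsymbol b(\theta)=\boldsymbol P^{-1/2}(\theta)\boldsymbol p'(\theta)$; $\boldsymbol\alpha(\theta)=\boldsymbol b(\theta)/|\boldsymbol b(\theta)|$; $\boldsymbol E_m$ the identity matrix of order $m$. With $G(x)=\Phi(x/\theta_0)$ and $\beta_0=-1$, let $\Delta(x,\Pi)=\sum_{j=0}^p[\mathsf{E}\,G(x+\beta_j\xi_j)-G(x)]$, where each $\xi_j$ has distribution $\Pi$ (and $\Delta(\pm\infty,\Pi)=0$); $\Delta_S(x,\Pi)=\frac{\Delta(x,\Pi)-\Delta(-x,\Pi)}{2}$; $\boldsymbol\delta(\Pi)=(\delta_1(\Pi),\dots,\delta_m(\Pi))^T$ with $\delta_j(\Pi)=2[\Delta_S(x_j,\Pi)-\Delta_S(x_{j-1},\Pi)]$. Then $$\hat\lambda^2(\gamma,\Pi)=\gamma^2\big|(\boldsymbol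 E_m-\boldsymbol\alpha(\theta_0)\boldsymbol\alpha(\theta_0)^T)\boldsymbol P^{-1/2}(\theta_0)\boldsymbol\delta(\Pi)\big|^2.$$ Background for the name: $\hat\alpha(\gamma,\Pi)$ is the limit of the rejection probability, under normal innovations with standard deviation $\theta_0$, of the test rejecting normality when the symmetrized Pearson statistic (computed from residuals of a stationary AR($p$) model with coefficients $\beta_1,\dots,\beta_p$, observed with outliers of distribution $\Pi$ occurring with probability $\min(1,\gamma/\sqrt n)$) exceeds $\chi_{m-2}(1-\alpha)$. *)

(* Defs.v *)
From HB Require Import structures.
From mathcomp Require Import all_boot all_order all_algebra.
From mathcomp Require Import complex.
From mathcomp Require Import all_classical all_reals all_analysis.
From mathcomp Require Import measurable_realfun.

Set Implicit Arguments.
Unset Strict Implicit.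
Unset Printing Implicit Defensive.

Import Order.TTheory GRing.Theory Num.Theory.
Import numFieldNormedType.Exports.

Local Open Scope classical_set_scope.
Local Open Scope ring_scope.

Section Distributions.
Context {R : realType}.

Definition dist_fun (P : probability (measurableTypeR R) R) (x : R) : R :=
  fine (P `]-oo, x]%classic).

Definition Phi (x : R) : R := dist_fun (normal_prob 0 1) x.

Definition ePhi (x : \bar R) : R :=
  match x with r%:E => Phi r | +oo%E => 1 | -oo%E => 0 end.

Definition sqr_add (zs : measurableTypeR R * measurableTypeR R) :
  measurableTypeR R := zs.1 ^+ 2 + zs.2.

Lemma measurable_sqr_add : measurable_fun [set: _] sqr_add.
Proof.
apply: measurable_funD; last exact: measurable_snd.
by apply: measurable_funX; exact: measurable_fst.
Qed.

HB.instance Definition _ :=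
  isMeasurableFun.Build _ _ _ _ sqr_add measurable_sqr_add.

(* The law of \sum_i Z_i ^ 2 for independent Z_i ~ N(mu_i, 1): independence
   enters as the product measure. *)
Fixpoint sqnorm_normal (mu : seq R) : probability (measurableTypeR R) R :=
  match mu with
  | [::] => \d_(0 : measurableTypeR R)
  | a :: mu' => distribution (normal_prob a 1 \x sqnorm_normal mu')%E sqr_add
  end.

(* The noncentral chi-square law with k >= 1 degrees of freedom and
   noncentrality lam2 >= 0 is the law of |Z|^2 for Z ~ N(mu, I_k) with
   |mu|^2 = lam2; by rotation invariance it does not depend on the direction
   of mu, taken here to be the first basis vector. *)
Definition ncchi2 (k : nat) (lam2 : R) : probability (measurableTypeR R) R :=
  sqnorm_normal (Num.sqrt lam2 :: nseq k.-1 0).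

Definition ncchi2_cdf (k : nat) (x lam2 : R) : R := dist_fun (ncchi2 k lam2) x.

Definition chi2_quantile (k : nat) (q : R) : R :=
  inf [set x : R | q <= ncchi2_cdf k x 0].

Definition enorm (n : nat) (v : 'cV[R]_n) : R :=
  Num.sqrt (\sum_i v i 0 ^+ 2).

End Distributions.

Section Noncentrality.
Context {R : realType}.
Variables (m p : nat) (theta0 : R) (beta : 'cV[R]_p) (x : 'I_m.+1 -> \bar R).

(* The cells are indexed by j : 'I_m, cell j having left end x_j and right end
   x_(j+1). *)
Definition cell_left (j : 'I_m) : \bar R := x (widen_ord (leqnSn m) j).
Definition cell_right (j : 'I_m) : \bar R := x (lift ord0 j).

Definition cell_prob (j : 'I_m) (theta : R) : R :=
  2 * (ePhi (cell_right j * (theta^-1)%:E)%E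
       - ePhi (cell_left j * (theta^-1)%:E)%E).

(* P(theta)^{-1/2} *)
Definition P_invsqrt (theta : R) : 'M[R]_m :=
  diag_mx (\row_j (Num.sqrt (cell_prob j theta))^-1).

Definition dcell_prob (theta : R) : 'cV[R]_m :=
  \col_j derive1 (cell_prob j) theta.

Definition bvec (theta : R) : 'cV[R]_m := P_invsqrt theta *m dcell_prob theta.

Definition alphavec (theta : R) : 'cV[R]_m :=
  (enorm (bvec theta))^-1 *: bvec theta.

Definition G (y : R) : R := Phi (y / theta0).

(* beta_0 = -1, and beta i 0 is beta_(i+1) for i : 'I_p. *)
Definition coef (j : 'I_p.+1) : R :=
  if unlift ord0 j is Some i then beta i 0 else -1.

Definition Delta (y : \bar R) (Pi : probability (measurableTypeR R) R) : R :=
  if y is r%:E then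
    \sum_(j < p.+1) (fine 'E_Pi[fun t : measurableTypeR R => G (r + coef j * t)]
                     - G r)
  else 0.

Definition DeltaS (y : \bar R) (Pi : probability (measurableTypeR R) R) : R :=
  (Delta y Pi - Delta (- y)%E Pi) / 2.

Definition deltavec (Pi : probability (measurableTypeR R) R) : 'cV[R]_m :=
  \col_j (2 * (DeltaS (cell_right j) Pi - DeltaS (cell_left j) Pi)).

Definition lambda2 (gamma : R) (Pi : probability (measurableTypeR R) R) : R :=
  gamma ^+ 2 *
  enorm ((1%:M - alphavec theta0 *m (alphavec theta0)^T)
         *m P_invsqrt theta0 *m deltavec Pi) ^+ 2.

Definition asymp_level (alpha gamma : R)
    (Pi : probability (measurableTypeR R) R) : R :=
  1 - ncchi2_cdf (m - 2) (chi2_quantile (m - 2) (1 - alpha)) (lambda2 gamma Pi).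

End Noncentrality.

(* Main.v *)
Require Import Defs.
From HB Require Import structures.
From mathcomp Require Import all_boot all_order all_algebra.
From mathcomp Require Import complex.
From mathcomp Require Import all_classical all_reals all_analysis.
From mathcomp Require Import ring lra measurable_realfun.

Import Order.TTheory GRing.Theory Num.Theory.
Import numFieldNormedType.Exports.

Local Open Scope classical_set_scope.
Local Open Scope ring_scope.
Local Open Scope complex_scope.

(** Only the first coordinate of the Gaussian vector moves with the noncentrality
    parameter, so the cdf of the noncentral chi-square law at any point varies by at
    most the total variation distance between N(0,1) and N(a,1), [a ^+ 2] being the
    noncentrality parameter; that distance is O(a). Since [G] takes values in [0, 1],
    [deltavec Pi] is bounded uniformly in [Pi], so [a] is O(gamma) uniformly in
    [Pi]. At [gamma = 0] the level is exactly [alpha] because the central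
    chi-square law has no atoms. *)

(** * Comparison of product measures that differ in one factor *)

Section product.
Context {d1 d2} {T1 : measurableType d1} {T2 : measurableType d2} {R : realType}.
Variables (P Q : probability T1 R) (W : probability T2 R).
Local Open Scope ereal_scope.

Lemma product_measure_ysection (A : set (T1 * T2)) : measurable A ->
  (P \x W) A = \int[W]_y P (ysection A y).
Proof.
move=> mA; have := indic_fubini_tonelli P W mA.
by rewrite indic_fubini_tonelli_FE// indic_fubini_tonelli_GE.
Qed.

(** By Tonelli, each side is the [W]-integral of the measures of the sections; the error [e]
    integrates to itself since [W] has mass 1. *)
Lemma product_measure_le_left (e : R) : (0 <= e)%R ->
  (forall A, measurable A -> P A <= Q A + e%:E) ->
  forall A : set (T1 * T2), measurable A -> (P \x W) A <= (Q \x W) A + e%:E.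
Proof.
move=> e0 PQ A mA.
rewrite product_measure_ysection//.
have := indic_fubini_tonelli Q W mA.
rewrite indic_fubini_tonelli_FE// indic_fubini_tonelli_GE// => HQ.
apply: (@le_trans _ _ (\int[W]_y (Q (ysection A y) + e%:E))); last first.
  rewrite ge0_integralD//=; last exact: measurable_fun_ysection.
  by rewrite integral_cst//= probability_setT mule1 -HQ.
apply: ge0_le_integral => //=.
- exact: measurable_fun_ysection.
- apply: emeasurable_funD => //; exact: measurable_fun_ysection.
- by move=> y _; exact/PQ/measurable_ysection.
Qed.

End product.

(** * Total variation bound between N(0,1) and N(a,1) *)

Section normal_prob.
Context {R : realType}.

Lemma normal_prob_countable0 (a s : R) (A : set (measurableTypeR R)) :
  countable A -> normal_prob a s A = 0%E.
Proof.
move=> cA; have mA : measurable A by exact: countable_measurable.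
have /null_content_dominatesP := normal_prob_dominates a s.
by apply => //; exact: countable_lebesgue_measure0.
Qed.

(* The factor 2 comes from [|a z| + a ^+ 2 / 2 <= 2 |a| expR (z ^+ 2 / 4)] for
   [|a| <= 1]; [expR (- z ^+ 2 / 4)] is the unnormalized N(0, 2) density. *)
Definition shift_const : R := 2 * (normal_peak 1 / normal_peak (Num.sqrt 2)).

Lemma shift_const_ge0 : 0 <= shift_const.
Proof. by rewrite /shift_const mulr_ge0// divr_ge0 ?normal_peak_ge0. Qed.

Lemma normal_pdf_shift_le (a z : R) : `|a| <= 1 ->
  normal_pdf 0 1 z <= normal_pdf a 1 z
    + shift_const * `|a| * normal_pdf 0 (Num.sqrt 2) z.
Proof.
move=> a1.
have s2 : Num.sqrt 2 != 0 :> R by rewrite gt_eqF// sqrtr_gt0.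
have p2 := normal_peak_gt0 s2.
rewrite !normal_pdfE ?oner_neq0// /shift_const /normal_fun sqr_sqrtr//.
rewrite expr1n subr0 /=.
have -> : 2 * (normal_peak 1 / normal_peak (Num.sqrt 2)) * `|a|
    * (normal_peak (Num.sqrt 2) * expR (- z ^+ 2 / (2 *+ 2)))
  = normal_peak 1 * (2 * `|a| * expR (- z ^+ 2 / (2 *+ 2))).
  by field; rewrite gt_eqF.
suff : expR (- z ^+ 2 / 2) <= expR (- (z - a) ^+ 2 / 2)
    + 2 * `|a| * expR (- z ^+ 2 / (2 *+ 2)).
  by move=> /(ler_wpM2l (normal_peak_ge0 1)); rewrite mulrDr.
set g := - z ^+ 2 / 2.
have -> : - (z - a) ^+ 2 / 2 = g + (a * z - a ^+ 2 / 2) by rewrite /g; field.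
have -> : - z ^+ 2 / (2 *+ 2) = g + z ^+ 2 / 4 by rewrite /g; field.
rewrite !(expRD g) (mulrCA _ (expR g)) -mulrDr ler_peMr ?expR_ge0//.
(* With [expR g] factored out, both remaining exponentials are bounded below by their tangents at 0.
   What is left, [|a z| + a ^+ 2 / 2 <= 2 |a| (1 + z ^+ 2 / 4)], follows from [a ^+ 2 <= |a|] and
   [2 |z| <= 1 + z ^+ 2]. *)
have h1 := expR_ge1Dx (a * z - a ^+ 2 / 2).
have h2 := expR_ge1Dx (z ^+ 2 / 4).
have h3 : `|a| * 2 * (1 + z ^+ 2 / 4) <= `|a| * 2 * expR (z ^+ 2 / 4).
  by rewrite ler_wpM2l.
have h4 : - (a * z) <= `|a| * `|z| by rewrite -normrM -normrN ler_norm.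
have h5 : a ^+ 2 <= `|a| by rewrite -[leLHS]real_normK ?num_real// expr2 ler_piMl.
have h6 : 0 <= `|a| * (`|z| - 1) ^+ 2 by rewrite mulr_ge0// sqr_ge0.
have h7 : z ^+ 2 = `|z| ^+ 2 by rewrite real_normK ?num_real.
rewrite h7 in h3 *.
nra.
Qed.

(** The pointwise density bound is integrated over [A]; the N(0,2) probability of [A] in the error
    term is at most 1. *)
Lemma normal_prob_shift_le (a : R) (A : set (measurableTypeR R)) :
  `|a| <= 1 -> measurable A ->
  (normal_prob 0 1 A <= normal_prob a 1 A + (shift_const * `|a|)%:E)%E.
Proof.
move=> a1 mA.
have mpdf (b s : R) : measurable_fun A (fun x => (normal_pdf b s x)%:E).
  by apply/measurable_EFinP/measurable_funTS; exact: measurable_normal_pdf.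
have c0 : 0 <= shift_const * `|a| by rewrite mulr_ge0// shift_const_ge0.
apply: (@le_trans _ _ (normal_prob a 1 A +
   (shift_const * `|a|)%:E * normal_prob 0 (Num.sqrt 2) A)%E).
  rewrite /normal_prob -ge0_integralZl//=; last first.
    by move=> x _; rewrite lee_fin normal_pdf_ge0.
  rewrite -ge0_integralD//=; first last.
  - exact: measurable_funeM.
  - by move=> x _; rewrite -EFinM lee_fin mulr_ge0// normal_pdf_ge0.
  - by move=> x _; rewrite lee_fin normal_pdf_ge0.
  apply: ge0_le_integral => //=.
  - by move=> x _; rewrite lee_fin normal_pdf_ge0.
  - by apply: emeasurable_funD => //; exact: measurable_funeM.
  - move=> x _; rewrite -EFinM -EFinD lee_fin.
    exact: normal_pdf_shift_le.
rewrite leeD2l// -[leRHS]mule1 lee_wpmul2l ?lee_fin//.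
exact: probability_le1.
Qed.

End normal_prob.

(** * Distribution functions and their quantiles *)

Section dist_fun.
Context {R : realType} (P : probability (measurableTypeR R) R).

Lemma dist_fun_le01 (c : R) : 0 <= dist_fun P c <= 1.
Proof.
rewrite /dist_fun fine_ge0//= -lee_fin fineK ?fin_num_measure//.
exact: probability_le1.
Qed.

Lemma dist_fun_nd : {homo dist_fun P : x y / x <= y}.
Proof.
move=> x y xy; rewrite /dist_fun fine_le ?fin_num_measure//.
by rewrite le_measure ?inE//; apply: subitvPr.
Qed.

Let X : measurableTypeR R -> R := idfun.
#[local] HB.instance Definition _ :=
  @isMeasurableFun.Build _ _ _ _ X (@measurable_id _ _ setT).

Lemma dist_fun_cvg0 : dist_fun P @ -oo --> (0 : R).
Proof. exact/fine_cvg/(@cvg_cdfNy0 _ _ _ _ (X : {RV P >-> R})). Qed.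

Lemma dist_fun_cvg1 : dist_fun P @ +oo --> (1 : R).
Proof. exact/fine_cvg/(@cvg_cdfy1 _ _ _ _ (X : {RV P >-> R})). Qed.

Lemma dist_fun_right_continuous (c : R) : dist_fun P @ c^'+ --> dist_fun P c.
Proof.
apply: fine_cvg; rewrite fineK ?fin_num_measure//.
exact: (@cdf_right_continuous _ _ _ _ (X : {RV P >-> R})).
Qed.

(** Continuity from below along the intervals ending at [c - 1/(n+1)] bounds the mass of the open
    half-line, and the null point [c] adds nothing. *)
Lemma dist_fun_left_lim (c q : R) : P [set c] = 0%E ->
  (forall x, x < c -> dist_fun P x <= q) -> dist_fun P c <= q.
Proof.
move=> Pc Fq.
have U : `]-oo, c[%classic = \bigcup_n `]-oo, c - n.+1%:R^-1]%classic :> set R.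
  apply/seteqP; split => x /=; rewrite in_itv/=.
    move=> /ltr_add_invr[k xk]; exists k => //=.
    by rewrite in_itv/= lerBrDr ltW.
  by move=> [k _] /=; rewrite in_itv/= => /le_lt_trans; apply; rewrite gtrBl.
have : P \o (fun n => `]-oo, c - n.+1%:R^-1]%classic) @ \oo --> P `]-oo, c[%classic.
  rewrite U; apply: nondecreasing_cvg_mu => //.
    by rewrite -U.
  move=> m n mn; apply/subsetPset/subset_itvl; rewrite bnd_simp.
  by rewrite lerB// lef_pV2 ?posrE// ler_nat.
move=> PU; have Pq := fun h => cvge_le (b := q%:E) h PU.
rewrite /dist_fun -lee_fin fineK ?fin_num_measure// -(@setUitv1 _ _ _ _ true)//.
rewrite (le_trans (measureU2 _ _ _))//= Pc adde0.
apply: Pq; apply: nearW => n /=.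
rewrite -[X in (X <= _)%E]fineK ?fin_num_measure// lee_fin.
by apply: Fq; rewrite gtrBl.
Qed.

(** Points left of the infimum lie outside the set, so absence of atoms gives [<= q]; points right
    of it lie above a member of the set, so right continuity gives [>= q]. *)
Lemma dist_fun_quantile (q : R) : 0 < q < 1 -> (forall c, P [set c] = 0%E) ->
  dist_fun P (inf [set x | q <= dist_fun P x]) = q.
Proof.
move=> /andP[q0 q1] P0; set S := [set x | _]; set c := inf S.
have Sne : S !=set0.
  have /cvgr_ge/(_ _ q1) := dist_fun_cvg1.
  by move=> /(@filter_ex _ _ _) [z ?]; exists z.
have [l ql] : exists l, dist_fun P l < q.
  have /cvgr_lt/(_ _ q0) := dist_fun_cvg0.
  by move=> /(@filter_ex _ _ _) [z ?]; exists z.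
have lbS : has_lbound S.
  exists l => x Sx; rewrite leNgt; apply/negP => /ltW/dist_fun_nd.
  by apply/negP; rewrite -ltNge; apply: lt_le_trans Sx.
apply/eqP; rewrite eq_le; apply/andP; split.
  apply: dist_fun_left_lim => // x xc; rewrite leNgt; apply/negP => /ltW Sx.
  by move: xc; apply/negP; rewrite -leNgt; apply: ge_inf.
apply: (cvgr_to_ge (dist_fun_right_continuous c)).
near=> x.
have [y Sy yx] : exists2 y, S y & y < x.
  by apply: (inf_lt Sne); near: x; exact: nbhs_right_gt.
by apply: le_trans Sy _; apply/dist_fun_nd/ltW.
Unshelve. all: by end_near. Qed.

End dist_fun.

(** A one-sided bound suffices: applied to the complement of the half-line, it yields the reverse
    inequality. *)
Lemma dist_fun_dist_le {R : realType} (P Q : probability (measurableTypeR R) R)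
    (e c : R) : (forall A, measurable A -> P A <= Q A + e%:E)%E ->
  `|dist_fun Q c - dist_fun P c| <= e.
Proof.
move=> PQ; have mI : measurable (`]-oo, c]%classic : set (measurableTypeR R)) by [].
have := PQ _ mI; have := PQ _ (measurableC mI).
rewrite !probability_setC// /dist_fun.
rewrite -[P _]fineK ?fin_num_measure// -[Q _]fineK ?fin_num_measure//=.
rewrite -!EFinB -!EFinD !lee_fin ler_norml; lra.
Qed.

(** * Chi-square laws: absence of atoms and dependence on the noncentrality *)

Section sqnorm_normal.
Context {R : realType}.

Lemma finite_sqr_preimage (t : R) : finite_set [set z : R | z ^+ 2 = t].
Proof.
apply: (@sub_finite_set _ _ [set Num.sqrt t; - Num.sqrt t]).
  move=> z /= <-; rewrite sqrtr_sqr.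
  by case: (ger0P z) => _; [left|right; rewrite opprK].
exact: finite_set2.
Qed.

(** Given the other summands [w], the first coordinate must solve [z ^+ 2 = t - w], a finite set,
    hence null for a normal law. *)
Lemma sqnorm_normal_set1 (a : R) mu (t : R) :
  sqnorm_normal (a :: mu) [set t] = 0%E.
Proof.
have mS : measurable (@sqr_add R @^-1` [set t]).
  rewrite -[X in measurable X]setTI; exact: measurable_sqr_add.
rewrite /= /distribution /pushforward product_measure_ysection//.
apply: integral0_eq => w _; apply: normal_prob_countable0.
apply: finite_set_countable.
apply: sub_finite_set (finite_sqr_preimage (t - w)) => z /=.
by rewrite /ysection/= inE /sqr_add /= => <-; rewrite addrK.
Qed.

Lemma dist_fun_sqnorm_normal_shift (a : R) mu (c : R) : `|a| <= 1 ->
  `|dist_fun (sqnorm_normal (a :: mu)) c - dist_fun (sqnorm_normal (0 :: mu)) c|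
    <= shift_const * `|a|.
Proof.
move=> a1; apply: dist_fun_dist_le => A mA.
have mS : measurable (@sqr_add R @^-1` A).
  rewrite -[X in measurable X]setTI; exact: measurable_sqr_add.
have e0 : 0 <= shift_const * `|a| by rewrite mulr_ge0// shift_const_ge0.
have shift B : measurable B -> (normal_prob 0 1 B <= normal_prob a 1 B +
    (shift_const * `|a|)%:E)%E by exact: normal_prob_shift_le.
have H := product_measure_le_left _ _ (sqnorm_normal mu) _ e0 shift _ mS.
by rewrite /= /distribution /pushforward.
Qed.

Lemma ncchi2_cdf_shift (k : nat) (c lam2 : R) : Num.sqrt lam2 <= 1 ->
  `|ncchi2_cdf k c lam2 - ncchi2_cdf k c 0| <= shift_const * Num.sqrt lam2.
Proof.
move=> l1; rewrite /ncchi2_cdf /ncchi2 sqrtr0.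
have l0 : `|Num.sqrt lam2| = Num.sqrt lam2 by rewrite ger0_norm ?sqrtr_ge0.
rewrite -[X in shift_const * X]l0.
by apply: dist_fun_sqnorm_normal_shift; rewrite l0.
Qed.

Lemma chi2_quantileK (k : nat) (q : R) : 0 < q < 1 ->
  ncchi2_cdf k (chi2_quantile k q) 0 = q.
Proof.
move=> q01; rewrite /ncchi2_cdf /chi2_quantile /ncchi2_cdf.
(* The list of means in [ncchi2] is a cons for every [k], so the law has no atoms. *)
by apply: (dist_fun_quantile (ncchi2 k 0)) => // c; exact: sqnorm_normal_set1.
Qed.

End sqnorm_normal.

(** * Bounds on the noncentrality, uniform in [Pi] *)

Section uniform_bounds.
Context {R : realType}.

Lemma fine_expectation_le01 (Pi : probability (measurableTypeR R) R)
    (f : measurableTypeR R -> R) : measurable_fun setT f ->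
  (forall t, 0 <= f t <= 1) -> 0 <= fine 'E_Pi[f]%E <= 1.
Proof.
move=> mf f01.
have E0 : (0 <= 'E_Pi[f])%E.
  by apply: expectation_ge0 => t; have /andP[] := f01 t.
have E1 : ('E_Pi[f] <= 1)%E.
  rewrite unlock -(probability_setT Pi) -[leRHS]mul1e -integral_cst//.
  apply: ge0_le_integral => //=.
  - by move=> t _; rewrite lee_fin; have /andP[] := f01 t.
  - exact/measurable_EFinP.
  - by move=> t _; rewrite lee_fin; have /andP[] := f01 t.
rewrite fine_ge0//= -lee_fin fineK// ge0_fin_numE//.
exact: le_lt_trans (ltry 1).
Qed.

Lemma Delta_le (p : nat) (theta0 : R) (beta : 'cV[R]_p) y
    (Pi : probability (measurableTypeR R) R) :
  `|Delta theta0 beta y Pi| <= p.+1%:R.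
Proof.
case: y => [r| |] /=; rewrite ?normr0//.
rewrite (le_trans (ler_norm_sum _ _ _))//.
rewrite -[p.+1 in leRHS]card_ord -sumr_const; apply: ler_sum => j _.
have G01 t : 0 <= G theta0 t <= 1 by exact: dist_fun_le01.
(* [Phi] is measurable because it is monotone. *)
have mG : measurable_fun [set: measurableTypeR R]
    (fun t : measurableTypeR R => G theta0 (r + coef beta j * t)).
  have mPhi : measurable_fun [set: measurableTypeR R] (@Phi R).
    by apply: nondecreasing_measurable => //; exact: dist_fun_nd.
  apply: (measurableT_comp mPhi).
  by apply: measurable_funM => //; apply: measurable_funD.
have /andP[E0 E1] := fine_expectation_le01 Pi _ mG (fun t => G01 _).
have /andP[G0 G1] := G01 r.
rewrite ler_norml; lra.
Qed.

Lemma deltavec_le (m p : nat) (theta0 : R) (beta : 'cV[R]_p) (x : 'I_m.+1 -> \bar R)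
    (Pi : probability (measurableTypeR R) R) (j : 'I_m) :
  `|deltavec theta0 beta x Pi j 0| <= 4 * p.+1%:R.
Proof.
rewrite mxE /DeltaS.
have := Delta_le p theta0 beta (cell_right x j) Pi.
have := Delta_le p theta0 beta (- cell_right x j)%E Pi.
have := Delta_le p theta0 beta (cell_left x j) Pi.
have := Delta_le p theta0 beta (- cell_left x j)%E Pi.
rewrite !ler_norml; lra.
Qed.

Lemma enorm_mulmx_le (m n : nat) (A : 'M[R]_(m, n)) (b : R) (v : 'cV[R]_n) :
  (forall j, `|v j 0| <= b) ->
  enorm (A *m v) ^+ 2 <= \sum_i (\sum_j `|A i j| * b) ^+ 2.
Proof.
move=> vb; rewrite /enorm sqr_sqrtr; last by apply: sumr_ge0 => i _; exact: sqr_ge0.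
apply: ler_sum => i _; rewrite -[leLHS]real_normK ?num_real// ler_pXn2r ?nnegrE//; last first.
  by apply: sumr_ge0 => j _; rewrite mulr_ge0// (le_trans _ (vb j)).
rewrite mxE (le_trans (ler_norm_sum _ _ _))//; apply: ler_sum => j _.
by rewrite normrM ler_wpM2l.
Qed.

(** [M] is chosen before [gamma] and [Pi]: the matrix [A] does not involve them, and the entries of
    [deltavec] have a bound free of [Pi]. *)
Lemma sqrt_lambda2_le (m p : nat) (theta0 : R) (beta : 'cV[R]_p)
    (x : 'I_m.+1 -> \bar R) :
  exists2 M : R, 0 <= M & forall gamma Pi,
    Num.sqrt (lambda2 theta0 beta x gamma Pi) <= `|gamma| * M.
Proof.
set A := (1%:M - alphavec x theta0 *m (alphavec x theta0)^T) *m P_invsqrt x theta0.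
exists (Num.sqrt (\sum_i (\sum_j `|A i j| * (4 * p.+1%:R)) ^+ 2)) => // gamma Pi.
rewrite /lambda2 sqrtrM ?sqr_ge0// sqrtr_sqr ler_wpM2l// ler_wsqrtr//.
by apply: enorm_mulmx_le => j; exact: deltavec_le.
Qed.

End uniform_bounds.

Theorem mainTheorem3 (R : realType) (alpha : R) (m p : nat) (theta0 : R)
    (beta : 'cV[R]_p) (x : 'I_m.+1 -> \bar R)
    (halpha : 0 < alpha < 1) (hm : (2 < m)%N) (htheta0 : 0 < theta0)
    (hp : (1 <= p)%N)
    (hroots : forall z : R[i],
      z ^+ p - \sum_(i < p) (beta i 0)%:C * z ^+ (p - i.+1) = 0 -> `|z| < 1)
    (hx0 : x ord0 = 0%E) (hxm : x ord_max = +oo%E)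
    (hx : forall i j : 'I_m.+1, (i < j)%N -> (x i < x j)%E) :
  ereal_sup [set (`|asymp_level theta0 beta x alpha gamma Pi - alpha|)%:E
            | Pi in [set: probability (measurableTypeR R) R]]
    @[gamma --> within `[0, +oo[%classic (nbhs (0 : R))] --> 0%E.
Proof.
have [M M0 HM] := sqrt_lambda2_le m p theta0 beta x.
have K0 := @shift_const_ge0 R.
have HM0 : `|g| * M @[g --> nbhs (0 : R)] --> (0 : R).
  have : `|g| * M @[g --> nbhs (0 : R)] --> `|0 : R| * M.
    by apply: cvgM; [exact: (@norm_continuous _ R^o)|exact: cvg_cst].
  by rewrite normr0 mul0r.
have small : \forall g \near nbhs (0 : R), `|g| * M <= 1.
  exact: (cvgr_le _ HM0).
(* Squeeze: the supremum lies between 0 and a multiple of [|g|]. *)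
have sq : \forall g \near nbhs (0 : R), (0%E <=
    ereal_sup [set (`|asymp_level theta0 beta x alpha g Pi - alpha|)%:E
            | Pi in [set: probability (measurableTypeR R) R]]
    <= (shift_const * (`|g| * M))%:E)%E.
  near=> g; apply/andP; split.
    (* The supremum is nonnegative once the set has a member; the Dirac mass at 0 supplies one. *)
    apply: le_ereal_sup_tmp.
    exists (`|asymp_level theta0 beta x alpha g (\d_(0 : measurableTypeR R)) - alpha|)%:E.
      by exists (\d_(0 : measurableTypeR R)).
    by rewrite lee_fin.
  apply: ge_ereal_sup => _ [Pi _ <-]; rewrite lee_fin.
  have g1 : `|g| * M <= 1 by near: g.
  have := ncchi2_cdf_shift (m - 2) (chi2_quantile (m - 2) (1 - alpha)) _
    (le_trans (HM g Pi) g1).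
  rewrite chi2_quantileK /asymp_level; last by lra.
  rewrite distrC (addrAC 1) => H.
  by apply: le_trans H _; rewrite ler_wpM2l.
have ub0 : (shift_const * (`|g| * M))%:E @[g --> nbhs (0 : R)] --> 0%E.
  apply: cvg_EFin; first exact: nearW.
  have : shift_const * (`|g| * M) @[g --> nbhs (0 : R)] --> shift_const * 0.
    by apply: cvgM; [exact: cvg_cst|exact: HM0].
  by rewrite mulr0.
(* The bounds hold for [gamma] of either sign, so the one-sided limit follows from the two-sided
   one. *)
apply: (cvg_within_filter (F := nbhs (0 : R))).
exact: (squeeze_cvge (f := fun=> 0%E) sq (cvg_cst _) ub0).
Unshelve. all: by end_near. Qed.
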